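(* Let $G$ be a strongly co-edge-regular graph with parameters $(n,k,2,\ell)$ and clique number $\omega$. If $\omega>\frac{\ell+4}{2}$, then $\ell=k-2$.
   Context: All graphs are finite, undirected and simple. A co-edge-regular graph with parameters $(n,k,c)$ is a $k$-regular graph on $n$ vertices, neither complete nor edgeless, in which any two distinct non-adjacent vertices have exactly $c$ common neighbours. For adjacent $x,y$, $a_{xy}$ is the number of common neighbours of $x,y$. A strongly co-edge-regular graph with parameters $(n,k,c,\ell)$ is a co-edge-regular graph with parameters $(n,k,c)$ such that for any two distinct non-adjacent vertices $x,z$, $\sum_{y\sim x,\,y\sim z}a_{xy}=\ell$. The clique number is the maximum size of a clique. *)

(* Defs.v *)
From mathcomp Require Import all_boot all_order all_algebra.
Set Implicit Arguments.
Unset Strict Implicit.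
Unset Printing Implicit Defensive.

Section Graphs.
Variables (T : finType) (e : rel T).

Definition simple_graph : Prop := symmetric e /\ irreflexive e.

Definition nbrs (x : T) : {set T} := [set y | e x y].

Definition common_nbrs (x y : T) : {set T} := nbrs x :&: nbrs y.

Definition regular (k : nat) : Prop := forall x, #|nbrs x| = k.

Definition complete_graph : Prop := forall x y, x != y -> e x y.

Definition edgeless : Prop := forall x y, ~~ e x y.

Definition co_edge_regular (n k c : nat) : Prop :=
  [/\ #|T| = n, regular k, ~ complete_graph, ~ edgeless &
      forall x y, x != y -> ~~ e x y -> #|common_nbrs x y| = c].

Definition strongly_co_edge_regular (n k c l : nat) : Prop :=
  co_edge_regular n k c /\
  forall x z, x != z -> ~~ e x z ->
    \sum_(y in common_nbrs x z) #|common_nbrs x y| = l.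

Definition clique (A : {set T}) : bool :=
  [forall x in A, forall y in A, (x != y) ==> e x y].

Definition clique_number : nat := \max_(A : {set T} | clique A) #|A|.

End Graphs.

(* Main.v *)
Require Import Defs.
From mathcomp Require Import all_boot all_order all_algebra.
From mathcomp Require Import zify.

(** Write [a x y] for the number of common neighbours of [x] and [y], and let
    [C] be a maximum clique, of size [w].  As [2 (w - 2) > l], no vertex outside
    [C] has two neighbours in [C], so [a y z = w - 2] for distinct [y], [z] in
    [C].  Given an edge from [z] in [C] to [x] outside [C], choose [y <> z] in
    [C]; the second common neighbour [x'] of [x] and [y] is non-adjacent to [z],
    and the common neighbours of [z] and [x'] are [y] and [x], so
    [a z x = l - (w - 2)].  A vertex [v] without neighbours in [C] would share
    with [z] in [C] two neighbours outside [C], giving [2 (l - (w - 2)) = l], which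
    is impossible; hence every vertex outside [C] has exactly one neighbour in
    [C].  Counting the edges between the neighbourhood of [x] and [C] in two
    ways gives [(k - 1) + (w - 1) = a z x + 2 (w - 1)], that is, [k = l + 2]. *)

Set Implicit Arguments.
Unset Strict Implicit.
Unset Printing Implicit Defensive.

Lemma in_common_nbrs (T : finType) (e : rel T) (x y v : T) :
  (v \in common_nbrs e x y) = e x v && e y v.
Proof. by rewrite !inE. Qed.

Lemma common_nbrsC (T : finType) (e : rel T) (x y : T) :
  common_nbrs e x y = common_nbrs e y x.
Proof. exact: setIC. Qed.

Lemma cliqueP (T : finType) (e : rel T) (A : {set T}) :
  reflect {in A &, forall x y, x != y -> e x y} (clique e A).
Proof.
apply: (iffP 'forall_in_'forall_in_implyP) => [h x y xA yA | h x xA y yA].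
  exact: h.
exact: h.
Qed.

Lemma clique_leq_clique_number (T : finType) (e : rel T) (A : {set T}) :
  clique e A -> #|A| <= clique_number e.
Proof. by move=> cA; apply: leq_bigmax_cond. Qed.

Lemma exists_maximum_clique (T : finType) (e : rel T) :
  exists2 A : {set T}, clique e A & #|A| = clique_number e.
Proof.
have c0 : clique e set0 by apply/cliqueP => x y; rewrite inE.
have [|A cA maxA] := @eq_bigmax_cond _ (clique e) (fun A : {set T} => #|A|).
  by apply/card_gt0P; exists set0.
by exists A => //; rewrite -maxA.
Qed.

(** Otherwise [x |: A] would be a larger clique. *)
Lemma maximum_clique_nonnbr (T : finType) (e : rel T) (A : {set T}) (x : T) :
  symmetric e -> clique e A -> #|A| = clique_number e -> x \notin A ->
  exists2 z, z \in A & ~~ e x z.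
Proof.
move=> esym /cliqueP cA maxA xA; apply/exists_inP; apply: contraT.
rewrite negb_exists_in => /forall_inP all_adj.
have adj z : z \in A -> e x z by move=> /all_adj /negbNE.
have cxA : clique e (x |: A).
  apply/cliqueP => u v /setU1P[->|uA] /setU1P[->|vA] uv; first by rewrite eqxx in uv.
  - exact: adj.
  - by rewrite esym adj.
  - exact: cA.
by have := clique_leq_clique_number cxA; rewrite cardsU1 xA -maxA; lia.
Qed.

Lemma cardsD2 (T : finType) (A : {set T}) (y z : T) :
  y \in A -> z \in A -> y != z -> #|A :\ y :\ z| + 2 = #|A|.
Proof.
move=> yA zA yz.
by rewrite (cardsD1 y A) (cardsD1 z (A :\ y)) yA !inE zA eq_sym yz /=; lia.
Qed.

Lemma card_common_nbrs_clique (T : finType) (e : rel T) (A : {set T}) (y z : T) :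
  clique e A -> y \in A -> z \in A -> y != z ->
  #|A| <= #|common_nbrs e y z| + 2.
Proof.
move=> /cliqueP cA yA zA yz.
rewrite -(cardsD2 yA zA yz) leq_add2r; apply/subset_leq_card/subsetP => v.
rewrite !inE => /and3P[vz vy vA].
by rewrite !cA // eq_sym.
Qed.

(** Since [c = 2], the vertices [y1] and [y2] exhaust the common neighbours, so the sum defining [l]
    has just these two terms. *)
Lemma strongly_co_edge_regular_pair (T : finType) (e : rel T) (n k l : nat)
    (x z y1 y2 : T) :
  strongly_co_edge_regular e n k 2 l -> x != z -> ~~ e x z -> y1 != y2 ->
  y1 \in common_nbrs e x z -> y2 \in common_nbrs e x z ->
  #|common_nbrs e x y1| + #|common_nbrs e x y2| = l.
Proof.
move=> [[_ _ _ _ c2] hl] xz nxz y12 y1c y2c.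
rewrite -(hl x z xz nxz).
have -> : common_nbrs e x z = [set y1; y2].
  apply/esym/eqP; rewrite eqEcard c2 // cards2 y12 andbT.
  by apply/subsetP => v /set2P[->|->].
by rewrite big_setU1 ?inE //= big_set1.
Qed.

Section LargeClique.

Variables (T : finType) (e : rel T) (n k l : nat) (A : {set T}).
Hypothesis esym : symmetric e.
Hypothesis eirr : irreflexive e.
Hypothesis hG : strongly_co_edge_regular e n k 2 l.
Hypothesis cA : clique e A.
Hypothesis maxA : #|A| = clique_number e.
Hypothesis largeA : l + 4 < 2 * #|A|.

Lemma adj_neq x y : e x y -> x != y.
Proof. by apply: contraTneq => ->; rewrite eirr. Qed.

Lemma notin_clique_neq x z : x \notin A -> z \in A -> x != z.
Proof. by move=> xA; apply: contraTneq => <-. Qed.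

Lemma other_common_nbr x y z :
  x != y -> ~~ e x y -> z \in common_nbrs e x y ->
  exists2 v, v != z & v \in common_nbrs e x y.
Proof.
move=> xy nxy zc; have [[_ _ _ _ c2] _] := hG.
have := c2 x y xy nxy; rewrite (cardsD1 z) zc => -[] /eqP/cards1P[v Hv].
have : v \in common_nbrs e x y :\ z by rewrite Hv set11.
by case/setD1P => vz vc; exists v.
Qed.

(** Maximality gives [z] in [A] not adjacent to [x]. If [y1] and [y2] differed, they would be the
    two common neighbours of [z] and [x], and each edge from [z] to them lies in at least [#|A| - 2]
    triangles inside [A], so [l >= 2 * (#|A| - 2)], against [largeA]. *)
Lemma nbr_in_clique_unique x y1 y2 :
  x \notin A -> y1 \in A -> y2 \in A -> e x y1 -> e x y2 -> y1 = y2.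
Proof.
move=> xA y1A y2A xy1 xy2; apply/eqP; apply: contraT => y12.
have [z zA nxz] := maximum_clique_nonnbr esym cA maxA xA.
have zx : z != x by rewrite eq_sym notin_clique_neq.
have zy1 : z != y1 by apply: contraNneq nxz => ->.
have zy2 : z != y2 by apply: contraNneq nxz => ->.
have /cliqueP adjA := cA.
have := @strongly_co_edge_regular_pair _ _ _ _ _ z x y1 y2 hG zx.
rewrite esym => /(_ nxz y12).
rewrite !in_common_nbrs xy1 xy2 !adjA // => /(_ isT isT).
have := card_common_nbrs_clique cA zA y1A zy1.
have := card_common_nbrs_clique cA zA y2A zy2.
lia.
Qed.

Lemma card_common_nbrs_maximum_clique y z :
  y \in A -> z \in A -> y != z -> #|common_nbrs e y z| + 2 = #|A|.
Proof.
move=> yA zA yz; apply/eqP; rewrite eqn_leq card_common_nbrs_clique // andbT.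
rewrite -(cardsD2 yA zA yz) leq_add2r; apply/subset_leq_card/subsetP => v.
rewrite in_common_nbrs !inE => /andP[yv zv].
rewrite ![v == _]eq_sym !adj_neq //=.
(* A common neighbour outside [A] would have both [y] and [z] as neighbours in [A]. *)
apply: contraT => vA; move/eqP: yz; case.
by apply: (nbr_in_clique_unique vA); rewrite // esym.
Qed.

Lemma card_common_nbrs_leaving_clique z x :
  z \in A -> x \notin A -> e z x -> #|common_nbrs e z x| + #|A| = l + 2.
Proof.
move=> zA xA zx.
have /set0Pn[y] : A :\ z != set0.
  by rewrite -card_gt0; move: largeA; rewrite (cardsD1 z A) zA; lia.
rewrite !inE => /andP[yz yA].
have /cliqueP adjA := cA.
have xz : e x z by rewrite esym.
have nxy : ~~ e x y.
  by apply: contraNN yz => xy; apply/eqP/(nbr_in_clique_unique xA).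
have zc : z \in common_nbrs e x y by rewrite in_common_nbrs xz adjA.
have [v vz] := other_common_nbr (notin_clique_neq xA yA) nxy zc.
rewrite in_common_nbrs => /andP[xv yv].
have vA : v \notin A.
  by apply: contraNN vz => vA; apply/eqP/(nbr_in_clique_unique xA).
have nzv : ~~ e z v.
  apply: contraNN yz => zv; apply/eqP.
  by apply: (nbr_in_clique_unique vA); rewrite // esym.
have zv : z != v by rewrite eq_sym.
(* Now [z], [y], [v], [x] form an induced 4-cycle; its diagonal [z], [v] relates the known count on
   the clique edge [z y] to the one on [z x]. *)
have := @strongly_co_edge_regular_pair _ _ _ _ _ z v y x hG zv nzv.
rewrite eq_sym notin_clique_neq // => /(_ isT).
rewrite !in_common_nbrs zx !(esym v) xv yv adjA 1?eq_sym // => /(_ isT isT).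
have := @card_common_nbrs_maximum_clique z y zA yA; rewrite eq_sym => /(_ yz).
lia.
Qed.

Lemma clique_dominating v : v \notin A -> exists2 z, z \in A & e v z.
Proof.
move=> vA; apply/exists_inP; apply: contraT.
rewrite negb_exists_in => /forall_inP nadj.
have /card_gt0P[z zA] : 0 < #|A| by move: largeA; lia.
have zv : z != v by rewrite eq_sym notin_clique_neq.
have nzv : ~~ e z v by rewrite esym nadj.
have [[_ _ _ _ c2] _] := hG.
have /card_gt0P[x xc] : 0 < #|common_nbrs e z v| by rewrite c2.
have [y yx yc] := other_common_nbr zv nzv xc.
(* Such a [u] is adjacent to [v], hence outside [A]. Adding the equations for [x] and [y] yields
   [2 * #|A| = l + 4], which [largeA] excludes. *)
have out u : u \in common_nbrs e z v -> #|common_nbrs e z u| + #|A| = l + 2.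
  rewrite in_common_nbrs => /andP[zu vu].
  by apply: card_common_nbrs_leaving_clique => //; apply: contraTN vu => /nadj.
have := strongly_co_edge_regular_pair hG zv nzv yx yc xc.
by have := out x xc; have := out y yc; move: largeA; lia.
Qed.

Lemma regularity_of_large_clique : k = l + 2.
Proof.
have [[_ reg nc _ c2] _] := hG.
have /cliqueP adjA := cA.
have [x xA] : exists x, x \notin A.
  apply/existsP; apply: contraT; rewrite negb_exists => /forallP allA.
  by case: nc => u v; apply: adjA; apply: negbNE.
have [z zA xz] := clique_dominating xA.
(* As [z] is the only neighbour of [x] in [A], such a [v] lies outside [A], where domination and
   uniqueness apply. *)
have count1 v : v \in nbrs e x :\ z -> #|nbrs e v :&: A| = 1.
  rewrite !inE => /andP[vz xv].
  have vA : v \notin A.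
    by apply: contraNN vz => vA; apply/eqP/(nbr_in_clique_unique xA).
  have [y yA vy] := clique_dominating vA.
  apply/eqP/cards1P; exists y; apply/setP => u; rewrite !inE.
  apply/andP/eqP => [[vu uA] | ->] //.
  exact: (nbr_in_clique_unique vA).
(* Both sides count the ordered pairs [(v, u)] with [e x v], [e v u] and [u] in [A]; [v] may be [z],
   itself in [A]. *)
have double : \sum_(v in nbrs e x) #|nbrs e v :&: A|
            = \sum_(y in A) #|common_nbrs e x y|.
  under eq_bigr => v _ do rewrite -sum1_card big_mkcond.
  under [RHS]eq_bigr => v _ do rewrite -sum1_card big_mkcond.
  rewrite [LHS]big_mkcond [RHS]big_mkcond /=.
  transitivity (\sum_v \sum_u ((e x v && e v u && (u \in A)) : nat)).
    apply: eq_bigr => v _; rewrite inE; case: (e x v) => /=; last by rewrite big1.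
    by apply: eq_bigr => u _; rewrite !inE; case: (_ && _).
  rewrite exchange_big; apply: eq_bigr => u _.
  case: (u \in A); last by rewrite big1 // => v _; rewrite andbF.
  by apply: eq_bigr => v _; rewrite !inE andbT (esym u); case: (_ && _).
have zN : z \in nbrs e x by rewrite inE.
(* The vertex [z] sees the rest of [A]; each of the other [k - 1] neighbours of [x] contributes
   1. *)
have sumL : \sum_(v in nbrs e x) #|nbrs e v :&: A| = #|A|.-1 + k.-1.
  rewrite (big_setD1 z) //=; congr (_ + _).
    rewrite (cardsD1 z A) zA /=; apply: eq_card => u; rewrite !inE.
    case uA: (u \in A); rewrite ?andbF // !andbT.
    apply/idP/idP => [/adj_neq|uz]; first by rewrite eq_sym.
    by rewrite adjA // eq_sym.
  rewrite -(reg x) (cardsD1 z (nbrs e x)) zN /= -sum1_card.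
  by apply: eq_bigr => v /count1.
(* Every [y] in [A] other than [z] is non-adjacent to [x], so it contributes [c = 2]. *)
have sumR : \sum_(y in A) #|common_nbrs e x y| = #|common_nbrs e z x| + 2 * #|A|.-1.
  rewrite (big_setD1 z) //= common_nbrsC; congr (_ + _).
  rewrite (cardsD1 z A) zA /= mulnC -sum_nat_const.
  apply: eq_bigr => y; rewrite !inE => /andP[yz yA].
  apply: c2; first exact: notin_clique_neq.
  by apply: contraNN yz => xy; apply/eqP/(nbr_in_clique_unique xA).
have := @card_common_nbrs_leaving_clique z x zA xA; rewrite esym => /(_ xz).
(* Positivity makes [k.-1] a true predecessor, not the truncated value at 0. *)
have k_gt0 : 0 < k by rewrite -(reg x); apply/card_gt0P; exists z.
by move: double largeA; rewrite sumL sumR; lia.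
Qed.

End LargeClique.

Unset Implicit Arguments.
Local Open Scope ring_scope.

Theorem theorem3p4 (T : finType) (e : rel T) (n k l : nat)
  (he : simple_graph e)
  (hG : strongly_co_edge_regular e n k 2 l)
  (hw : (l%:R + 4%:R) / 2%:R < (clique_number e)%:R :> rat) :
  l%:Z = k%:Z - 2%:Z.
Proof.
have [esym eirr] := he.
have [A cA maxA] := exists_maximum_clique e.
have largeA : (l + 4 < 2 * #|A|)%N.
  move: hw; rewrite Num.Theory.ltr_pdivrMr // -GRing.natrD -GRing.natrM.
  by rewrite Num.Theory.ltr_nat maxA mulnC.
rewrite (regularity_of_large_clique esym eirr hG cA maxA largeA); lia.
Qed.
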